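(* There is a constant $A_{\mathbb{I}}<\infty$ such that for every $n\ge 1$, the spherical maximal operator $M_{\mathcal S}$ on the $n$-dimensional hypercube satisfies $\|M_{\mathcal S}\|_{2\to 2}<A_{\mathbb{I}}$; that is, for all $n$ and all $f:\{0,1\}^n\to\mathbb{R}$, $\|M_{\mathcal S}f\|_2\le A_{\mathbb{I}}\|f\|_2$.
   Context: Let $\mathbb{I}^n=\{0,1\}^n$ with Hamming distance $d(x,y)=|\{i:x_i\ne y_i\}|$, and let $V=\mathbb{R}^{\mathbb{I}^n}$ be the space of real-valued functions on it, with $\|f\|_2=(\sum_x f(x)^2)^{1/2}$. For $0\le k\le n$ the spherical mean $S_k:V\to V$ is $(S_kf)(x)=\binom{n}{k}^{-1}\sum_{y:\,d(x,y)=k}f(y)$. The spherical maximal operator is $(M_{\mathcal S}f)(x)=\max_{0\le k\le n}(S_kf)(x)$. For a (sublinear) operator $M$, $\|M\|_{2\to2}=\sup_{f\ne0}\|Mf\|_2/\|f\|_2$. *)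

(* Defs.v *)
From mathcomp Require Import all_boot all_order all_algebra.
Set Implicit Arguments. Unset Strict Implicit. Unset Printing Implicit Defensive.
Import Order.TTheory GRing.Theory Num.Theory.
Local Open Scope ring_scope.

Definition cube (n : nat) := {ffun 'I_n -> bool}.

Definition hamming (n : nat) (x y : cube n) : nat := #|[set i | x i != y i]|.

Definition sph_mean (R : realFieldType) (n k : nat) (f : cube n -> R) (x : cube n) : R :=
  ('C(n, k)%:R)^-1 * \sum_(y : cube n | hamming x y == k) f y.

Definition sph_max (R : realFieldType) (n : nat) (f : cube n -> R) (x : cube n) : R :=
  \big[Num.max/sph_mean 0 f x]_(k < n.+1) sph_mean k f x.

Definition l2norm (R : rcfType) (n : nat) (f : cube n -> R) : R :=
  Num.sqrt (\sum_(x : cube n) f x ^+ 2).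

(* Main.v *)
Require Import Defs.
From mathcomp Require Import all_boot all_order all_algebra.
From mathcomp Require Import reals.
From mathcomp Require Import zify ring lra.
Import Order.TTheory GRing.Theory Num.Theory.
Set Implicit Arguments. Unset Strict Implicit. Unset Printing Implicit Defensive.
Local Open Scope ring_scope.

(* Cesaro averages of the powers of the one-step mean [S_1] satisfy an L2 maximal
   inequality by a TT* argument. The Ehrenfest walk of step [S_1] visits each level
   [s <= K <= n/8] with probability bounded below before time [2K + 1], so these
   averages dominate the Cesaro averages of the spherical means [S_0, ..., S_K];
   for [K > n/8] the latter are at most a constant times the average over all radii.
   Following Nevo and Stein, [S_2m] differs from the Cesaro mean of [S_0, S_2, ..., S_2m]
   by at most the square function [(\sum_j (j + 1) |S_(2j+2) f - S_2j f|^2)^(1/2)], whose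
   L2 norm is controlled on the Fourier side by [\sum_k k |kap_k(x) - kap_(k-1)(x)|^2], where
   [kap] is the normalised Krawtchouk polynomial. Since
   [kap_k^n(x) - kap_(k-1)^n(x) = - (2x/n) kap_(k-1)^(n-1)(x-1)], a decay of [kap_k^n(x)] like
   [(1 + kx/n)^-2] for [k, x <= n/2] suffices. Odd radii reduce to even ones through [S_1],
   and radii above [n/2] to those below through the antipodal map. *)

(** * Maximal ergodic inequality *)

Lemma le_of_sqr (R : realFieldType) (a b : R) : 0 <= b -> a ^+ 2 <= b ^+ 2 -> a <= b.
Proof.
move=> b0 H; apply: le_trans (ler_norm _) _.
by rewrite -(@ler_pXn2r _ 2) ?nnegrE ?normr_ge0 // real_normK ?num_real.
Qed.

Lemma sqr_le_sqr (R : realFieldType) (a b : R) : 0 <= a -> a <= b -> a ^+ 2 <= b ^+ 2.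
Proof. by move=> a0 ab; rewrite ler_pXn2r ?nnegrE // (le_trans a0). Qed.

Lemma sum_cauchy_schwarz (R : realFieldType) (I : Type) (r : seq I) (P : pred I)
    (a b : I -> R) :
  (\sum_(i <- r | P i) a i * b i) ^+ 2 <=
  (\sum_(i <- r | P i) a i ^+ 2) * (\sum_(i <- r | P i) b i ^+ 2).
Proof.
elim: r => [|i r IH]; first by rewrite !big_nil mulr0 expr2 mulr0.
rewrite !big_cons; case: (P i) => //.
set A := \sum_(_ <- _ | _) a _ ^+ 2 in IH *; set B := \sum_(_ <- _ | _) b _ ^+ 2 in IH *.
set C := \sum_(_ <- _ | _) _ in IH *.
have A0 : 0 <= A by apply: sumr_ge0 => j _; exact: sqr_ge0.
have B0 : 0 <= B by apply: sumr_ge0 => j _; exact: sqr_ge0.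
(* The cross term is handled by AM-GM for [a i ^+ 2 * B] and [A * b i ^+ 2], after squaring both
   sides and inserting [C ^+ 2 <= A * B]. *)
have key : 2 * (a i * b i) * C <= a i ^+ 2 * B + A * b i ^+ 2.
  apply: le_of_sqr; first by apply: addr_ge0; apply: mulr_ge0 => //; exact: sqr_ge0.
  apply: (@le_trans _ _ (4 * (a i * b i) ^+ 2 * (A * B))).
    have -> : (2 * (a i * b i) * C) ^+ 2 = 4 * (a i * b i) ^+ 2 * C ^+ 2 by ring.
    by apply: ler_wpM2l => //; rewrite mulr_ge0 ?sqr_ge0.
  rewrite -subr_ge0.
  have -> : (a i ^+ 2 * B + A * b i ^+ 2) ^+ 2 - 4 * (a i * b i) ^+ 2 * (A * B)
    = (a i ^+ 2 * B - A * b i ^+ 2) ^+ 2 by ring.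
  exact: sqr_ge0.
have -> : (a i * b i + C) ^+ 2 = (a i * b i) ^+ 2 + 2 * (a i * b i) * C + C ^+ 2 by ring.
have -> : (a i ^+ 2 + A) * (b i ^+ 2 + B)
  = (a i * b i) ^+ 2 + (a i ^+ 2 * B + A * b i ^+ 2) + A * B by ring.
by rewrite !lerD.
Qed.

Lemma sum_shift_le (R : realFieldType) (F : nat -> R) (s T : nat) :
  (forall u, 0 <= F u) -> (s <= T)%N ->
  \sum_(t < T) F (s + t)%N <= \sum_(u < T.*2) F u.
Proof.
move=> F0 sT; have -> : T.*2 = (s + (T + (T - s)))%N by lia.
rewrite (@big_split_ord _ _ _ s) /= (@big_split_ord _ _ _ T) /=.
by rewrite addrCA lerDl addr_ge0 // sumr_ge0.
Qed.

Section MaximalErgodic.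
Variables (R : realFieldType) (X : finType) (p : X -> X -> R).
Hypothesis p_ge0 : forall x y, 0 <= p x y.
Hypothesis p_sym : forall x y, p x y = p y x.
Hypothesis p_sum1 : forall x, \sum_y p x y = 1.

Definition kact (a : X -> X -> R) (f : X -> R) (x : X) : R := \sum_y a x y * f y.

Fixpoint kpow (t : nat) (x y : X) : R :=
  if t is t'.+1 then \sum_z p x z * kpow t' z y else (x == y)%:R.

Definition cesaro (T : nat) (x y : X) : R := T%:R^-1 * \sum_(t < T) kpow t x y.

Lemma kpow_ge0 t x y : 0 <= kpow t x y.
Proof.
by elim: t x => [|t IH] x /=; [rewrite ler0n | apply: sumr_ge0 => z _; rewrite mulr_ge0].
Qed.

Lemma kpowD s t x y : kpow (s + t) x y = \sum_z kpow s x z * kpow t z y.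
Proof.
elim: s x => [|s IH] x /=.
  rewrite (bigD1 x) //= eqxx mul1r big1 ?addr0 // => z zx.
  by rewrite eq_sym (negPf zx) mul0r.
under eq_bigr => z _ do rewrite IH mulr_sumr.
rewrite exchange_big /=; apply: eq_bigr => z _.
by rewrite mulr_suml; apply: eq_bigr => w _; rewrite mulrA.
Qed.

Lemma kpow1 x y : kpow 1 x y = p x y.
Proof.
rewrite /= (bigD1 y) //= eqxx mulr1 big1 ?addr0 // => z zy.
by rewrite (negPf zy) mulr0.
Qed.

Lemma kpow_sym t x y : kpow t x y = kpow t y x.
Proof.
elim: t x y => [|t IH] x y; first by rewrite /= eq_sym.
rewrite -{2}addn1 kpowD [LHS]/=; apply: eq_bigr => z _.
by rewrite kpow1 p_sym IH mulrC.
Qed.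

Lemma kpow_sum1 t x : \sum_y kpow t x y = 1.
Proof.
elim: t x => [|t IH] x /=.
  rewrite (bigD1 x) //= eqxx big1 ?addr0 // => z zx.
  by rewrite eq_sym (negPf zx).
rewrite exchange_big /= -(p_sum1 x); apply: eq_bigr => z _.
by rewrite -mulr_sumr IH mulr1.
Qed.

Lemma kact_kpow t f x : kact (kpow t) f x = iter t (kact p) f x.
Proof.
elim: t x => [|t IH] x /=.
  rewrite /kact (bigD1 x) //= eqxx mul1r big1 ?addr0 // => z zx.
  by rewrite eq_sym (negPf zx) mul0r.
rewrite /kact /=; under eq_bigr => z _ do rewrite mulr_suml.
rewrite exchange_big /=; apply: eq_bigr => z _.
by rewrite -IH /kact mulr_sumr; apply: eq_bigr => w _; rewrite mulrA.
Qed.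

Lemma kact_cesaro T f x :
  kact (cesaro T) f x = T%:R^-1 * \sum_(t < T) iter t (kact p) f x.
Proof.
rewrite /kact /cesaro; under eq_bigr => z _ do rewrite -mulrA mulr_suml.
rewrite -mulr_sumr exchange_big /=; congr (_ * _); apply: eq_bigr => t _.
by rewrite -kact_kpow.
Qed.

Lemma cesaro_ge0 T x y : 0 <= cesaro T x y.
Proof. by rewrite mulr_ge0 ?invr_ge0 ?ler0n // sumr_ge0 // => t _; exact: kpow_ge0. Qed.

Lemma cesaro_sum1 T x : (0 < T)%N -> \sum_y cesaro T x y = 1.
Proof.
move=> T0; rewrite -mulr_sumr exchange_big /=.
under eq_bigr => t _ do rewrite kpow_sum1.
by rewrite sumr_const card_ord mulVf // pnatr_eq0 -lt0n.
Qed.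

(** By symmetry of [p] and the semigroup law, the left side averages [kpow (s + t)] over [s < S] and
    [t < T]. For fixed [s] these times lie below [2T], and averaging over [2T] times instead of [T]
    costs the factor 2. *)
Lemma cesaro_mul_le S T x z : (0 < S <= T)%N ->
  \sum_y cesaro S x y * cesaro T z y <= 2 * cesaro T.*2 x z.
Proof.
case/andP=> S0 ST; have T0 : (0 < T)%N by exact: leq_trans S0 ST.
have -> : \sum_y cesaro S x y * cesaro T z y =
  S%:R^-1 * \sum_(s < S) (T%:R^-1 * \sum_(t < T) kpow (s + t) x z).
  rewrite -mulr_sumr /cesaro.
  under eq_bigr => y _ do rewrite mulrACA.
  rewrite -mulr_sumr -mulrA; congr (_ * (_ * _)).
  under eq_bigr => y _ do rewrite mulr_suml.
  rewrite exchange_big /=; apply: eq_bigr => s _.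
  under eq_bigr => y _ do rewrite mulr_sumr.
  rewrite exchange_big /=; apply: eq_bigr => t _.
  by rewrite kpowD; apply: eq_bigr => y _; rewrite (kpow_sym t z).
have -> : 2 * cesaro T.*2 x z = S%:R^-1 * \sum_(s < S) (2 * cesaro T.*2 x z).
  by rewrite sumr_const card_ord -[X in _ = _ * X]mulr_natl mulrA mulVf ?mul1r // pnatr_eq0 -lt0n.
apply: ler_wpM2l; first by rewrite invr_ge0 ler0n.
apply: ler_sum => s _; rewrite /cesaro -muln2 natrM invfM.
have -> : 2 * (T%:R^-1 * 2^-1 * \sum_(t < T * 2) kpow t x z) =
   T%:R^-1 * \sum_(t < T * 2) kpow t x z by field; rewrite pnatr_eq0 -lt0n.
apply: ler_wpM2l; first by rewrite invr_ge0 ler0n.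
rewrite muln2; apply: (sum_shift_le (F := fun t => kpow t x z)).
- by move=> u; exact: kpow_ge0.
- exact: leq_trans (ltnW (ltn_ord s)) ST.
Qed.

Lemma cesaro_mul_le2 S T x z : (0 < S)%N -> (0 < T)%N ->
  \sum_y cesaro S x y * cesaro T z y <= 2 * (cesaro S.*2 x z + cesaro T.*2 z x).
Proof.
have cesaro_sym U u v : cesaro U u v = cesaro U v u.
  by congr (_ * _); apply: eq_bigr => t _; exact: kpow_sym.
move=> S0 T0; have [ST|/ltnW TS] := leqP S T.
  apply: le_trans (cesaro_mul_le x z _) _; first by rewrite S0.
  by rewrite ler_wpM2l // [leLHS]cesaro_sym lerDr cesaro_ge0.
under eq_bigr => y _ do rewrite mulrC.
apply: le_trans (cesaro_mul_le z x _) _; first by rewrite T0.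
by rewrite ler_wpM2l // [leLHS]cesaro_sym lerDl cesaro_ge0.
Qed.

(** The choice [tau] linearises the supremum over times. [L] bounds the squared norm uniformly in
    [tau], so it may also be used at [2 tau]. *)
Definition maximal_bound (L : R) : Prop :=
  forall (tau : X -> nat) (f : X -> R), (forall x, (0 < tau x)%N) ->
    (forall x, 0 <= f x) ->
    \sum_x kact (cesaro (tau x)) f x ^+ 2 <= L * \sum_x f x ^+ 2.

(* TT* argument: the kernel of T T^*, where T f x = A_(tau x) f x, is bounded by
   the kernels of the same type attached to 2 tau, and of their adjoints. *)
Lemma maximal_bound_improve (l : R) :
  0 <= l -> maximal_bound (l ^+ 2) -> maximal_bound (4 * l).
Proof.
move=> l0 HL tau f tau0 f0.
set h := fun x => kact (cesaro (tau x)) f x.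
have h0 x : 0 <= h x by apply: sumr_ge0 => y _; rewrite mulr_ge0 ?cesaro_ge0.
(* [G] is T^* h, so that [E1] reads <Tf, h> = <f, T^* h>. *)
set G := fun y => \sum_x h x * cesaro (tau x) x y.
set H := fun x => kact (cesaro (tau x).*2) h x.
set A := \sum_x h x ^+ 2; set F := \sum_x f x ^+ 2.
have A0 : 0 <= A by apply: sumr_ge0 => x _; exact: sqr_ge0.
have F0 : 0 <= F by apply: sumr_ge0 => x _; exact: sqr_ge0.
have E1 : A = \sum_y f y * G y.
  transitivity (\sum_x \sum_y h x * cesaro (tau x) x y * f y).
    by apply: eq_bigr => x _; rewrite expr2 {2}/h /kact mulr_sumr; apply: eq_bigr => y _; rewrite mulrA.
  by rewrite exchange_big /=; apply: eq_bigr => y _; rewrite mulrC mulr_suml.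
have E3 : \sum_y G y ^+ 2 =
    \sum_x \sum_z h x * h z * \sum_y cesaro (tau x) x y * cesaro (tau z) z y.
  under eq_bigr => y _ do rewrite expr2 /G big_distrlr /=.
  rewrite exchange_big /=; apply: eq_bigr => x _.
  rewrite exchange_big /=; apply: eq_bigr => z _.
  by rewrite mulr_sumr; apply: eq_bigr => y _; rewrite mulrACA.
have E4 : \sum_y G y ^+ 2 <= 4 * \sum_x h x * H x.
  have -> : 4 * \sum_x h x * H x =
    \sum_x \sum_z h x * h z * (2 * (cesaro (tau x).*2 x z + cesaro (tau z).*2 z x)).
    have e1 : \sum_x h x * H x = \sum_x \sum_z h x * h z * cesaro (tau x).*2 x z.
      apply: eq_bigr => x _; rewrite /H /kact mulr_sumr; apply: eq_bigr => z _.
      by ring.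
    transitivity (2 * (\sum_x \sum_z h x * h z * cesaro (tau x).*2 x z) +
       2 * (\sum_x \sum_z h x * h z * cesaro (tau z).*2 z x)).
      rewrite [X in _ = _ + 2 * X]exchange_big /= e1.
      under [X in _ = _ + 2 * X]eq_bigr => x _.
        under eq_bigr => z _ do rewrite (mulrC (h z) (h x)).
        over.
      by rewrite -mulrDl; congr (_ * _); ring.
    rewrite !mulr_sumr -big_split /=; apply: eq_bigr => x _.
    rewrite !mulr_sumr -big_split /=; apply: eq_bigr => z _; ring.
  rewrite E3; apply: ler_sum => x _; apply: ler_sum => z _.
  by apply: ler_wpM2l; [rewrite mulr_ge0 | exact: cesaro_mul_le2].
(* Cauchy-Schwarz and the assumed bound for [h] at the doubled times: the constant enters only
   through its square root [l]. *)
have E5 : \sum_x h x * H x <= l * A.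
  apply: le_of_sqr; first exact: mulr_ge0.
  apply: le_trans (sum_cauchy_schwarz _ _ _ _) _.
  rewrite exprMn expr2 -/A (expr2 A) mulrA mulrC ler_wpM2r // -expr2.
  by apply: HL => // x; rewrite double_gt0.
have : A ^+ 2 <= 4 * l * F * A.
  rewrite {1}E1; apply: le_trans (sum_cauchy_schwarz _ _ _ _) _; rewrite -/F.
  have -> : 4 * l * F * A = F * (4 * (l * A)) by ring.
  by apply: ler_wpM2l => //; apply: le_trans E4 _; rewrite ler_wpM2l.
have [->|A1] := eqVneq A 0; first by rewrite !mulr_ge0.
by rewrite expr2 ler_pM2r // lt_neqAle eq_sym A1.
Qed.

(** Row entries lie in [0, 1] and sum to 1, so their squares sum to at most 1, and each point
    contributes at most [\sum_y f y ^+ 2]. *)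
Lemma maximal_bound_card : maximal_bound #|X|%:R.
Proof.
move=> tau f tau0 f0; rewrite -sum1_card natr_sum mulr_suml.
apply: ler_sum => x _; rewrite mul1r.
have a1 y : cesaro (tau x) x y <= 1.
  rewrite -(cesaro_sum1 x (tau0 x)) (bigD1 y) //= lerDl.
  by apply: sumr_ge0 => z _; exact: cesaro_ge0.
apply: (@le_trans _ _ ((\sum_y cesaro (tau x) x y ^+ 2) * (\sum_y f y ^+ 2))).
  exact: sum_cauchy_schwarz.
apply: ler_piMl; first by apply: sumr_ge0 => y _; exact: sqr_ge0.
rewrite -[leRHS](cesaro_sum1 x (tau0 x)); apply: ler_sum => y _.
by rewrite expr2 ler_piMl // cesaro_ge0.
Qed.

(* Bootstraps the trivial constant [#|X|] through [L |-> 4 sqrt L], which brings any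
   constant close to its fixed point 16 in finitely many steps. *)
Lemma maximal_ergodic : maximal_bound 32.
Proof.
(* On constants [16 * 2 ^+ (2 ^ j)] one improvement lowers [j] by 1, and [j = 0] gives 32. *)
have step j : maximal_bound (16 * 2 ^+ (2 ^ j)) -> maximal_bound 32.
  elim: j => [|j IH] H; first by have -> : 32 = 16 * 2 ^+ (2 ^ 0) :> R by rewrite expn0 expr1; ring.
  apply: IH; have -> : 16 * 2 ^+ (2 ^ j) = 4 * (4 * 2 ^+ (2 ^ j)) :> R by ring.
  apply: maximal_bound_improve; first by rewrite mulr_ge0 ?exprn_ge0.
  have -> : (4 * 2 ^+ (2 ^ j)) ^+ 2 = 16 * 2 ^+ (2 ^ j.+1) :> R by rewrite expnSr exprM; ring.
  exact: H.
apply: (step #|X|) => tau f tau0 f0.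
apply: le_trans (maximal_bound_card tau0 f0) _.
apply: ler_wpM2r; first by apply: sumr_ge0 => x _; exact: sqr_ge0.
rewrite -natrX -natrM ler_nat.
have := ltn_expl #|X| (isT : (1 < 2)%N); have := ltn_expl (2 ^ #|X|) (isT : (1 < 2)%N); lia.
Qed.

End MaximalErgodic.

(** * Characters and Krawtchouk polynomials *)

Section Fourier.
Variable R : realFieldType.

(** The Walsh characters of the group (Z/2)^n. *)
Definition chi n (a y : cube n) : R := \prod_i (-1) ^+ (a i && y i).

Definition wt n (a : cube n) : nat := #|[set i | a i]|.

Definition fourier n (f : cube n -> R) (a : cube n) : R := \sum_y f y * chi a y.

(** Krawtchouk polynomial, taken as a coefficient of its generating function so that recurrences
    come from polynomial identities. *)
Definition kraw n k x : R := ((1 - 'X) ^+ x * (1 + 'X) ^+ (n - x) : {poly R})`_k.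

(** The eigenvalue of [S_k] on characters of weight [x], see [fourier_sph_mean]. *)
Definition kap n k x : R := kraw n k x / 'C(n, k)%:R.

Lemma wt_le n (a : cube n) : (wt a <= n)%N.
Proof. by rewrite -[leqRHS]card_ord; exact: max_card. Qed.

Lemma hamming0 n (y : cube n) : hamming [ffun=> false] y = wt y.
Proof. by apply: eq_card => i; rewrite !inE ffunE; case: (y i). Qed.

Lemma hammingC n (x y : cube n) : hamming x y = hamming y x.
Proof. by apply: eq_card => i; rewrite !inE (eq_sym (x i)). Qed.

Lemma hammingE n (x y : cube n) : hamming x y = (\sum_i (x i != y i))%N.
Proof.
by rewrite /hamming -sum1_card big_mkcond /=; apply: eq_bigr => i _; rewrite inE; case: ifP.
Qed.

Lemma chiC n (a y : cube n) : chi a y = chi y a.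
Proof. by apply: eq_bigr => i _; rewrite andbC. Qed.

Lemma chi0 n (a : cube n) : chi a [ffun=> false] = 1.
Proof. by apply: big1 => i _; rewrite ffunE andbF. Qed.

(** Marking each [y] by the monomial of degree [hamming x y] turns the sphere condition into a
    coefficient; the unrestricted sum then factors over coordinates. *)
Lemma sphere_chi n k (a x : cube n) :
  \sum_(y | hamming x y == k) chi a y = chi a x * kraw n k (wt a).
Proof.
have -> : \sum_(y | hamming x y == k) chi a y =
    (\sum_y (chi a y *: 'X^(hamming x y)) : {poly R})`_k.
  rewrite coef_sum big_mkcond /=; apply: eq_bigr => y _.
  by rewrite coefZ coefXn eq_sym; case: eqP; rewrite ?mulr1 ?mulr0.
have -> : \sum_y (chi a y *: 'X^(hamming x y)) =
    \prod_i \sum_b ((-1) ^+ (a i && b) *: 'X^(x i != b)) :> {poly R}.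
  rewrite bigA_distr_bigA /=; apply: eq_bigr => y _.
  by rewrite scaler_prod hammingE (prodrXr 'X).
under eq_bigr => i _.
  have -> : \sum_b ((-1) ^+ (a i && b) *: 'X^(x i != b)) =
      (-1) ^+ (a i && x i) *: (1 + (-1) ^+ (a i) *: 'X) :> {poly R}.
    rewrite big_bool; case: (a i); case: (x i) => /=;
      by rewrite ?expr0 ?expr1 ?scaleN1r ?scale1r ?opprD ?opprK // addrC.
  over.
rewrite scaler_prod coefZ; congr (_ * _); rewrite /kraw.
suff -> : \prod_i (1 + (-1) ^+ (a i) *: 'X) =
  (1 - 'X) ^+ wt a * (1 + 'X) ^+ (n - wt a) :> {poly R} by [].
rewrite (bigID (fun i => a i)) /=; congr (_ * _).
  rewrite (eq_bigr (fun=> 1 - 'X)); last by move=> i ->; rewrite expr1 scaleN1r.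
  by rewrite prodr_const /wt cardsE.
rewrite (eq_bigr (fun=> 1 + 'X)); last by move=> i /negPf ->; rewrite expr0 scale1r.
rewrite prodr_const; congr (_ ^+ _).
have <- : #|~: [set i | a i]| = #|fun i : 'I_n => ~~ a i|.
  by apply: eq_card => i; rewrite !inE.
by have := cardsC [set i | a i]; rewrite card_ord => e; apply/eqP; rewrite -(eqn_add2l (wt a)) subnKC ?wt_le // e.
Qed.

Lemma kraw_at0 n k : kraw n k 0 = 'C(n, k)%:R.
Proof.
rewrite /kraw expr0 mul1r subn0 addrC exprD1n coef_sum.
have [kn|kn] := ltnP k n.+1.
  rewrite (bigD1 (Ordinal kn)) //= coefMn coefXn eqxx big1 ?addr0 //.
  move=> i ik; rewrite coefMn coefXn; case: eqP => [e|_]; last by rewrite mul0rn.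
  by case/eqP: ik; apply/val_inj.
rewrite bin_small // big1 // => i _; rewrite coefMn coefXn.
by case: eqP => [e|_]; [move: (ltn_ord i); lia | rewrite mul0rn].
Qed.

Lemma card_sphere n k (x : cube n) : #|[pred y | hamming x y == k]|%:R = 'C(n, k)%:R :> R.
Proof.
have := sphere_chi k [ffun=> false] x.
rewrite (_ : wt _ = 0%N); last by apply: eq_card0 => i; rewrite !inE ffunE.
rewrite kraw_at0 chiC chi0 mul1r => <-.
by rewrite -sum1_card natr_sum; apply: eq_bigr => y _; rewrite chiC chi0.
Qed.

(** This form is symmetric in the two spheres; it yields the symmetry, the trivial bound and the
    reflection formula for [kraw]. *)
Lemma chi_double_sum n x k :
  \sum_(a : cube n | wt a == x) \sum_(y : cube n | wt y == k) chi a y =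
  'C(n, x)%:R * kraw n k x.
Proof.
rewrite -(card_sphere x ([ffun=> false] : cube n)) -sum1_card natr_sum mulr_suml.
apply: eq_big => [a|a /eqP <-]; first by rewrite inE hamming0.
rewrite mul1r -[RHS]mul1r -(chi0 a) -sphere_chi.
by apply: eq_bigl => y; rewrite hamming0.
Qed.

Lemma kraw_sym n x k : 'C(n, x)%:R * kraw n k x = 'C(n, k)%:R * kraw n x k.
Proof.
rewrite -!chi_double_sum exchange_big /=; apply: eq_bigr => a _.
by apply: eq_bigr => y _; rewrite chiC.
Qed.

Lemma normr_chi n (a y : cube n) : `|chi a y| = 1.
Proof. by rewrite /chi normr_prod big1 // => i _; rewrite normrX normrN1 expr1n. Qed.

Lemma kraw_bound n x k : (x <= n)%N -> `|kraw n k x| <= 'C(n, k)%:R.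
Proof.
move=> xn; have C0 : 0 < 'C(n, x)%:R :> R by rewrite ltr0n bin_gt0.
rewrite -(ler_pM2l C0) -{1}(normr_nat R 'C(n, x)) -normrM -chi_double_sum.
apply: le_trans (ler_norm_sum _ _ _) _.
rewrite -{1}(card_sphere x ([ffun=> false] : cube n)) -sum1_card natr_sum mulr_suml.
rewrite [leRHS](eq_bigl (fun a => wt a == x)); last by move=> a; rewrite inE hamming0.
apply: ler_sum => a _; rewrite mul1r -(card_sphere k ([ffun=> false] : cube n)).
apply: le_trans (ler_norm_sum _ _ _) _; rewrite -sum1_card natr_sum.
rewrite [leRHS](eq_bigl (fun a => wt a == k)); last by move=> y; rewrite inE hamming0.
by apply: ler_sum => y _; rewrite normr_chi.
Qed.

Definition compl n (a : cube n) : cube n := [ffun i => ~~ a i].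

Lemma complK n : involutive (@compl n).
Proof. by move=> a; apply/ffunP => i; rewrite !ffunE negbK. Qed.

Lemma hamming_compl n (x y : cube n) : hamming (compl x) y = (n - hamming x y)%N.
Proof.
have := cardsC [set i | x i != y i]; rewrite card_ord.
rewrite (_ : ~: _ = [set i | compl x i != y i]); first by rewrite /hamming; lia.
by apply/setP => i; rewrite !inE ffunE; case: (x i); case: (y i).
Qed.

Lemma wt_compl n (a : cube n) : wt (compl a) = (n - wt a)%N.
Proof. by rewrite -!hamming0 hammingC hamming_compl hammingC. Qed.

Lemma chi_compl n (a y : cube n) : chi (compl a) y = (-1) ^+ wt y * chi a y.
Proof.
have -> : wt y = (\sum_i y i)%N.
  by rewrite -hamming0 hammingE; apply: eq_bigr => i _; rewrite ffunE; case: (y i).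
rewrite -prodrXr /chi -big_split /=; apply: eq_bigr => i _.
by rewrite ffunE; case: (a i); case: (y i); rewrite ?expr0 ?expr1 ?mulr1 ?mulN1r ?opprK.
Qed.

Lemma kraw_compl n k x : (x <= n)%N -> kraw n k (n - x) = (-1) ^+ k * kraw n k x.
Proof.
move=> xn; have C0 : 'C(n, x)%:R != 0 :> R by rewrite pnatr_eq0 -lt0n bin_gt0.
apply: (mulfI C0); rewrite -{1}bin_sub // mulrCA -!chi_double_sum.
rewrite (reindex_inj (can_inj (@complK n))) /= mulr_sumr.
apply: eq_big => [a|a _]; first by rewrite wt_compl; have := wt_le a; lia.
by rewrite mulr_sumr; apply: eq_bigr => y /eqP <-; rewrite chi_compl.
Qed.

(** The generating function gains the factor (1 - X)(1 + X) = 1 - X^2. *)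
Lemma kraw_rec n k x : (x <= n)%N ->
  kraw n.+2 k.+2 x.+1 = kraw n k.+2 x - kraw n k x.
Proof.
move=> xn; rewrite /kraw (_ : n.+2 - x.+1 = (n - x).+1)%N; last lia.
set P := (1 - 'X) ^+ x * (1 + 'X) ^+ (n - x).
have -> : (1 - 'X) ^+ x.+1 * (1 + 'X) ^+ (n - x).+1 = P - P * 'X^2 :> {poly R}.
  by rewrite /P !exprS; ring.
by rewrite coefB coefMXn /= subn2.
Qed.

Lemma kraw_diff n k x : (x <= n)%N ->
  kraw n.+1 k.+1 x.+1 - kraw n.+1 k.+1 x = - 2 * kraw n k x.
Proof.
move=> xn; rewrite /kraw -coefB subSS subSn //.
set P := (1 - 'X) ^+ x * (1 + 'X) ^+ (n - x).
have -> : (1 - 'X) ^+ x.+1 * (1 + 'X) ^+ (n - x) - (1 - 'X) ^+ x * (1 + 'X) ^+ (n - x).+1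
  = (- 2)%:P * (P * 'X) :> {poly R} by rewrite /P !exprS polyCN polyC_natr; ring.
by rewrite coefCM coefMX.
Qed.

(** The logarithmic derivative of the generating function, cleared of denominators; its coefficients
    give the three-term recurrence. *)
Lemma kraw_deriv n x : (x <= n)%N ->
  let F := (1 - 'X) ^+ x * (1 + 'X) ^+ (n - x) : {poly R} in
  (1 - 'X ^+ 2) * F^`() = (n%:R - 2 * x%:R)%:P * F - n%:R%:P * (F * 'X).
Proof.
move=> xn F.
have e1 : (1 - 'X) * ((1 - 'X) ^+ x)^`() = - x%:R%:P * (1 - 'X) ^+ x :> {poly R}.
  rewrite deriv_exp derivB derivX -polyC1 derivC sub0r mulN1r mulNrn mulrN polyC1.
  case: x {xn F} => [|x]; first by rewrite mulr0n mulr0 polyC0 oppr0 mul0r.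
  by rewrite polyC_natr exprS /= -mulr_natr; ring.
have e2 m : (1 + 'X) * ((1 + 'X) ^+ m)^`() = m%:R%:P * (1 + 'X) ^+ m :> {poly R}.
  rewrite deriv_exp derivD derivX -polyC1 derivC add0r mul1r polyC1.
  case: m => [|m]; first by rewrite mulr0n mulr0 mul0r.
  by rewrite polyC_natr -mulr_natl exprS mulrCA.
rewrite /F derivM.
have -> : (1 - 'X ^+ 2) * (((1 - 'X) ^+ x)^`() * (1 + 'X) ^+ (n - x)
     + (1 - 'X) ^+ x * ((1 + 'X) ^+ (n - x))^`()) =
  ((1 - 'X) * ((1 - 'X) ^+ x)^`()) * ((1 + 'X) * (1 + 'X) ^+ (n - x)) +
  ((1 + 'X) * ((1 + 'X) ^+ (n - x))^`()) * ((1 - 'X) * (1 - 'X) ^+ x) :> {poly R} by ring.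
rewrite e1 e2 natrB // !polyCB polyCM !polyC_natr; ring.
Qed.

Lemma kraw_three_term n k x : (x <= n)%N ->
  k.+2%:R * kraw n k.+2 x + (n%:R - k%:R) * kraw n k x = (n%:R - 2 * x%:R) * kraw n k.+1 x.
Proof.
move=> xn; have := congr1 (fun p : {poly R} => p`_k.+1) (kraw_deriv xn).
rewrite /= mulrBl mul1r !coefB !coefCM coefMX /= expr2 -mulrA coefXM /= coef_deriv.
rewrite coefXM /kraw; set F := _ * _.
have -> : (if k == 0%N then 0 else F^`()`_k.-1) = k%:R * F`_k.
  by case: k => [|k]; rewrite ?mul0r // coef_deriv mulr_natl.
rewrite -[F`_k.+2 *+ _]mulr_natl => /(canRL (subrK _)) ->; ring.
Qed.

Lemma kraw0 n x : kraw n 0 x = 1.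
Proof. by rewrite /kraw -horner_coef0 !hornerE ?horner_exp ?hornerE ?subr0 ?addr0 ?expr1n ?mulr1. Qed.

Lemma kraw1 n x : (x <= n)%N -> kraw n 1 x = n%:R - 2 * x%:R.
Proof.
move=> xn; have := congr1 (fun p : {poly R} => p`_0) (kraw_deriv xn).
rewrite /= mulrBl mul1r !coefB !coefCM coefMX /= expr2 -mulrA coefXM /= coef_deriv.
by rewrite /= !subr0 mulr1n mulr0 subr0 -!/(kraw n _ x) kraw0 mulr1.
Qed.

(** When [k > n] the binomial is 0; [kraw_bound] then makes [kraw] vanish, in agreement with the
    default value of the quotient. *)
Lemma kraw_kap n k x : (x <= n)%N -> kraw n k x = 'C(n, k)%:R * kap n k x.
Proof.
move=> xn; rewrite /kap; have [e|e] := eqVneq ('C(n, k)%:R : R) 0; last by rewrite mulrC divfK.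
by have := kraw_bound k xn; rewrite e normr_le0 mul0r => /eqP.
Qed.

Lemma kap_sym n k x : (k <= n)%N -> (x <= n)%N -> kap n k x = kap n x k.
Proof.
move=> kn xn; have := kraw_sym n x k; rewrite !kraw_kap //.
rewrite mulrA mulrA (mulrC 'C(n, k)%:R); apply: mulfI.
by rewrite mulf_neq0 // pnatr_eq0 -lt0n bin_gt0.
Qed.

Lemma kap_bound n k x : (x <= n)%N -> `|kap n k x| <= 1.
Proof.
move=> xn; rewrite /kap normrM normfV normr_nat.
have [->|/lt0n_neq0] := posnP 'C(n, k); first by rewrite invr0 mulr0.
by rewrite -lt0n => C0; rewrite ler_pdivrMr ?ltr0n // mul1r kraw_bound.
Qed.

Lemma kap_compl n k x : (x <= n)%N -> kap n k (n - x) = (-1) ^+ k * kap n k x.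
Proof. by move=> xn; rewrite /kap kraw_compl // mulrA. Qed.

(** The eigenvalue form of [n S_1 S_k = k S_(k-1) + (n - k) S_(k+1)]; the junk index [0.-1] carries
    weight 0. *)
Lemma kap_three_term n k x : (k <= n)%N -> (x <= n)%N ->
  n%:R * (kap n 1 x * kap n k x) = k%:R * kap n k.-1 x + (n%:R - k%:R) * kap n k.+1 x.
Proof.
move=> kn xn.
have k1 : n%:R * kap n 1 x = n%:R - 2 * x%:R.
  by rewrite -kraw1 // kraw_kap // bin1.
rewrite mulrA k1; case: k kn => [|k] kn.
  by rewrite mul0r add0r subr0 k1 /kap kraw0 bin0 divr1 mulr1.
have C0 : 'C(n, k.+1)%:R != 0 :> R by rewrite pnatr_eq0 -lt0n bin_gt0.
apply: (mulfI C0); have := kraw_three_term k xn; rewrite !kraw_kap //.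
have b1 : k.+2%:R * 'C(n, k.+2)%:R = (n%:R - k.+1%:R) * 'C(n, k.+1)%:R :> R.
  by rewrite -natrM mul_bin_left natrM natrB.
have b2 : k.+1%:R * 'C(n, k.+1)%:R = (n%:R - k%:R) * 'C(n, k)%:R :> R.
  by rewrite -natrM mul_bin_left natrM natrB // ltnW.
rewrite !mulrA b1 -b2 => H; rewrite /=.
rewrite [_ * (n%:R - 2 * _)]mulrC -H; ring.
Qed.

Lemma chi_orthogonal n (y z : cube n) :
  \sum_a chi a y * chi a z = if y == z then 2 ^+ n else 0.
Proof.
transitivity (\prod_(i < n) \sum_(b : bool) ((-1) ^+ (b && y i) * (-1) ^+ (b && z i)) : R).
  by rewrite bigA_distr_bigA /=; apply: eq_bigr => a _; rewrite -big_split.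
have E i : \sum_(b : bool) ((-1) ^+ (b && y i) * (-1) ^+ (b && z i)) =
    if y i == z i then 2 else 0 :> R.
  rewrite big_bool /= !expr0 mulr1.
  by case: (y i); case: (z i); rewrite ?expr0 ?expr1 /=; ring.
under eq_bigr => i _ do rewrite E.
case: eqP => [->|/eqP yz].
  under eq_bigr => i _ do rewrite eqxx.
  by rewrite prodr_const card_ord.
have /existsP[i yzi] : [exists i, y i != z i].
  apply: contraNT yz; rewrite negb_exists => /forallP H; apply/eqP/ffunP => i.
  by apply/eqP; move: (H i); rewrite negbK.
by rewrite (bigD1 i) //= (negPf yzi) mul0r.
Qed.

Lemma plancherel n (f : cube n -> R) :
  \sum_a fourier f a ^+ 2 = 2 ^+ n * \sum_x f x ^+ 2.
Proof.
under eq_bigr => a _ do rewrite expr2 /fourier big_distrlr /=.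
rewrite exchange_big /= mulr_sumr; apply: eq_bigr => x _.
rewrite exchange_big /= (bigD1 x) //= [X in _ + X]big1 ?addr0.
  under eq_bigr => a _ do rewrite mulrACA.
  by rewrite -mulr_sumr chi_orthogonal eqxx expr2 mulrC.
move=> z zx; under eq_bigr => a _ do rewrite mulrACA.
by rewrite -mulr_sumr chi_orthogonal eq_sym (negPf zx) mulr0.
Qed.

(** Plancherel for [f - g]. Operator identities can thus be checked on multipliers. *)
Lemma fourier_inj n (f g : cube n -> R) : fourier f =1 fourier g -> f =1 g.
Proof.
move=> fg x; pose h x := f x - g x.
have h0 a : fourier h a = 0.
  have -> : fourier h a = fourier f a - fourier g a.
    by rewrite -sumrB; apply: eq_bigr => y _; rewrite mulrBl.
  by rewrite fg subrr.
have := plancherel h; rewrite big1; last by move=> a _; rewrite h0 expr0n.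
move/esym/eqP; rewrite mulf_eq0 expf_eq0 pnatr_eq0 andbF /= psumr_eq0; last by move=> *; exact: sqr_ge0.
by move/allP/(_ x (mem_index_enum _)); rewrite /= sqrf_eq0 subr_eq0 => /eqP.
Qed.

Lemma fourier_sph_mean n k (f : cube n -> R) a :
  fourier (sph_mean k f) a = kap n k (wt a) * fourier f a.
Proof.
rewrite /fourier /sph_mean /kap [RHS]mulrC mulrA mulr_suml.
under [LHS]eq_bigr => x _ do rewrite -mulrA mulr_suml big_mkcond /=.
rewrite -mulr_sumr exchange_big /= [LHS]mulrC; congr (_ * _); apply: eq_bigr => y _.
rewrite -mulrA -sphere_chi mulr_sumr [RHS]big_mkcond; apply: eq_bigr => x _.
by rewrite hammingC.
Qed.

End Fourier.

(** * Decay of Krawtchouk polynomials *)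

Section Krawtchouk.
Variable R : realFieldType.
Local Notation kraw := (@kraw R).
Local Notation kap := (@kap R).

(** Pascal's rule used twice leaves the deficit [2 * 'C(n, k.+1)], and the ratio of ['C(n, k.+1)] to
    ['C(n.+2, k.+2)] is (k + 2)(n - k) / ((n + 2)(n + 1)). *)
Lemma bin_step_le (a b N : R) n k :
  0 <= a -> 0 <= b -> 0 < N -> a <= k.+2%:R -> b <= (n - k)%:R -> n.+2%:R <= N ->
  'C(n, k.+2)%:R + 'C(n, k)%:R <= 'C(n.+2, k.+2)%:R * (1 - 2 * a * b / N ^+ 2).
Proof.
move=> a0 b0 N0 ak bk nN.
have N2 : 0 < N ^+ 2 by rewrite exprn_gt0.
have E : 'C(n.+2, k.+2)%:R * (k.+2%:R * (n - k)%:R) = n.+2%:R * n.+1%:R * 'C(n, k.+1)%:R :> R.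
  rewrite -!natrM; congr (_%:R).
  have /= e1 := mul_bin_diag n.+2 k.+1; have /= e2 := mul_bin_down n.+1 k.+1.
  by rewrite -[RHS]mulnA e2 subSS [RHS]mulnCA e1 mulnA mulnC (mulnC 'C(_, _)).
have S : 'C(n.+2, k.+2)%:R = 'C(n, k.+2)%:R + 2 * 'C(n, k.+1)%:R + 'C(n, k)%:R :> R.
  by rewrite !binS !natrD; ring.
have H : 'C(n.+2, k.+2)%:R * (a * b) <= N ^+ 2 * 'C(n, k.+1)%:R.
  apply: (@le_trans _ _ ('C(n.+2, k.+2)%:R * (k.+2%:R * (n - k)%:R))).
    by rewrite ler_wpM2l // ler_pM.
  rewrite E expr2 ler_wpM2r // ler_pM //.
  by apply: le_trans nN; rewrite ler_nat.
have : 'C(n.+2, k.+2)%:R * (a * b) / N ^+ 2 <= 'C(n, k.+1)%:R.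
  by rewrite ler_pdivrMr // [leRHS]mulrC.
set c := _ / _ => Hc.
have -> : 'C(n.+2, k.+2)%:R * (1 - 2 * a * b / N ^+ 2) = 'C(n.+2, k.+2)%:R - 2 * c.
  by rewrite /c; ring.
rewrite S; lra.
Qed.

(** Iterates [kraw_rec] [m] times. Each use lowers [k] and [n - k] by at most 2, so the margin
    [2 * m] keeps them above [a] and [b], and each use gains the factor of [bin_step_le]. *)
Lemma kraw_decay (a b N : R) m n k x :
  0 <= a -> 0 <= b -> 0 < N -> a + (2 * m)%:R <= k%:R -> b + (2 * m)%:R <= (n - k)%:R ->
  n%:R <= N -> (k <= n)%N -> (m <= x)%N -> (x + m <= n)%N ->
  `|kraw n k x| <= 'C(n, k)%:R * (1 - 2 * a * b / N ^+ 2) ^+ m.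
Proof.
move=> a0 b0 N0; elim: m n k x => [|m IH] n k x.
  by move=> _ _ _ _ _ xn; rewrite expr0 mulr1 kraw_bound //; lia.
move=> ak bk nN kn mx xmn.
have k2 : (2 <= k)%N.
  rewrite -(ler_nat R); apply: le_trans ak; apply: (@le_trans _ _ (2 * m.+1)%:R); last by rewrite lerDr.
  by rewrite ler_nat; lia.
have nk2 : (2 <= n - k)%N.
  rewrite -(ler_nat R); apply: le_trans bk; apply: (@le_trans _ _ (2 * m.+1)%:R); last by rewrite lerDr.
  by rewrite ler_nat; lia.
case: n k x kn k2 nk2 mx xmn ak bk nN => [|[|n]] [|[|k]] [|x] // kn _ nk2 mx xmn ak bk nN.
have xn : (x <= n)%N by lia.
have kn2 : (k.+2 <= n)%N by lia.
have kn0 : (k <= n)%N by lia.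
have xmn' : (x + m <= n)%N by lia.
have nkE : (n - k = (n - k.+2) + 2)%N by lia.
have dmN : (2 * m.+1 = 2 * m + 2)%N by lia.
rewrite kraw_rec //; apply: le_trans (ler_normB _ _) _.
have dm : (2 * m.+1)%:R = (2 * m)%:R + 2 :> R by rewrite dmN natrD.
have m0 : 0 <= (2 * m)%:R :> R by [].
have nk : (n.+2 - k.+2)%:R = (n - k)%:R :> R by rewrite !subSS.
have nk' : (n - k)%:R = (n - k.+2)%:R + 2 :> R by rewrite nkE natrD.
have k2 : k.+2%:R = k%:R + 2 :> R by rewrite -natrD addn2.
have nn : n%:R <= n.+2%:R :> R by rewrite ler_nat leqW // leqW.
rewrite dm nk in bk; rewrite dm in ak.
apply: (@le_trans _ _ (('C(n, k.+2)%:R + 'C(n, k)%:R) * (1 - 2 * a * b / N ^+ 2) ^+ m)).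
  rewrite mulrDl lerD //; apply: IH => //; lra.
have B : 'C(n, k.+2)%:R + 'C(n, k)%:R <= 'C(n.+2, k.+2)%:R * (1 - 2 * a * b / N ^+ 2).
  apply: bin_step_le => //; lra.
move: B; set rho := 1 - _ => B; rewrite exprS mulrA ler_wpM2r // exprn_ge0 //.
(* [rho >= 0] is read off from [B], whose left side is nonnegative. *)
have C0 : 0 < 'C(n.+2, k.+2)%:R :> R by rewrite ltr0n bin_gt0.
by rewrite -(pmulr_rge0 _ C0); apply: le_trans B; rewrite addr_ge0.
Qed.

(** Bernoulli's inequality in reverse form, turning geometric decay into decay like 1 / (1 + q
    u). *)
Lemma expr_1B_le (u : R) q : 0 <= u <= 1 -> (1 - u) ^+ q * (1 + q%:R * u) <= 1.
Proof.
move=> /andP[u0 u1]; elim: q => [|q IH]; first by rewrite expr0 mul0r addr0 mulr1.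
apply: le_trans IH; rewrite exprSr -mulrA ler_wpM2l ?exprn_ge0 ?subr_ge0 //.
rewrite -natr1 -subr_ge0.
have -> : 1 + q%:R * u - (1 - u) * (1 + (q%:R + 1) * u) = (q%:R + 1) * u ^+ 2 by ring.
by rewrite mulr_ge0 ?sqr_ge0 // addr_ge0.
Qed.

(* By symmetry [x <= k]; then about x/4 applications of [kraw_rec] keep the second
   index and its complement at least k/2 and n/4, so each gains a factor 1 - k/(4n). *)
Lemma kap_decay n k x : (0 < n)%N -> (2 * k <= n)%N -> (2 * x <= n)%N ->
  `|kap n k x| <= (32 / (28 + k%:R * x%:R / n%:R)) ^+ 2.
Proof.
move=> n0; wlog xk : k x / (x <= k)%N.
  move=> H kn xn; have [xk|/ltnW kx] := leqP x k; first exact: H.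
  by rewrite kap_sym; [rewrite (mulrC k%:R); exact: H | lia..].
move=> kn xn.
(* [2 * q] steps will be used, the even exponent producing the square in the claim. *)
have [q q8 q8'] : exists2 q, (8 * q <= x)%N & (x <= 8 * q + 7)%N by exists (x %/ 8)%N; lia.
have kn' : (k <= n)%N by lia.
have q4 : (2 * (2 * q) = 4 * q)%N by lia.
have qx : (2 * q <= x)%N by lia.
have xqn : (x + 2 * q <= n)%N by lia.
have C0 : 0 < 'C(n, k)%:R :> R by rewrite ltr0n bin_gt0.
have N0 : 0 < n%:R :> R by rewrite ltr0n.
have rq8 : 8 * q%:R <= x%:R :> R by rewrite -natrM ler_nat.
have rq8' : x%:R <= 8 * q%:R + 7 :> R by rewrite -natrM -natrD ler_nat.
have rkn : 2 * k%:R <= n%:R :> R by rewrite -natrM ler_nat.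
have rxn : 2 * x%:R <= n%:R :> R by rewrite -natrM ler_nat.
have rxk : x%:R <= k%:R :> R by rewrite ler_nat.
have q0 : 0 <= q%:R :> R by [].
have k0 : 0 <= k%:R :> R by [].
pose u : R := k%:R / (4 * n%:R).
have u0 : 0 <= u by rewrite divr_ge0 // mulr_ge0.
have u8 : u <= 1 / 8 by rewrite ler_pdivrMr ?mulr_gt0 //; lra.
have D : `|kap n k x| <= (1 - u) ^+ (2 * q).
  rewrite /kap normrM normfV normr_nat ler_pdivrMr // mulrC.
  have -> : u = 2 * (k%:R / 2) * (n%:R / 4) / n%:R ^+ 2.
    by rewrite /u; field; rewrite gt_eqF.
  have e4 : (2 * (2 * q))%:R = 4 * q%:R :> R by rewrite q4 natrM.
  apply: kraw_decay => //; [by rewrite divr_ge0 | by rewrite divr_ge0 | |].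
    by rewrite e4; lra.
  by rewrite e4 natrB //; lra.
apply: le_trans D _; rewrite mulnC exprM ler_pXn2r ?nnegrE //; last 2 first.
- by rewrite exprn_ge0 // subr_ge0; lra.
- by rewrite divr_ge0 // addr_ge0 // divr_ge0 // mulr_ge0.
have t0 : 0 <= k%:R * x%:R / n%:R :> R by rewrite divr_ge0 // mulr_ge0.
rewrite ler_pdivlMr; last lra.
have /expr_1B_le : 0 <= u <= 1 by rewrite u0; lra.
move=> /(_ q); have p0 : 0 <= (1 - u) ^+ q by rewrite exprn_ge0 // subr_ge0; lra.
(* [x <= 8 q + 7] gives k x / n = 4 u x <= 32 q u + 28 u, and [u <= 1 / 8] leaves 28 u < 4 = 32 -
   28. *)
have W : 28 + k%:R * x%:R / n%:R <= 32 * (1 + q%:R * u).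
  have -> : k%:R * x%:R / n%:R = 4 * u * x%:R by rewrite /u; field; rewrite gt_eqF.
  have : u * x%:R <= u * (8 * q%:R + 7) by rewrite ler_wpM2l.
  by rewrite mulrDr; lra.
have := ler_wpM2l p0 W; lra.
Qed.

(** Symmetry moves the difference in [k] to the other argument, where [kraw_diff] applies. *)
Lemma kap_step n k x : (k <= n)%N -> (x <= n)%N ->
  kap n.+1 k.+1 x.+1 - kap n.+1 k x.+1 = - 2 * (x.+1%:R / n.+1%:R) * kap n k x.
Proof.
move=> kn xn; rewrite !(@kap_sym _ n.+1 _ x.+1) // ?(@kap_sym _ n k) //; last exact: leqW.
rewrite /kap -mulrBl kraw_diff // kraw_kap // /kap.
have C0 : 'C(n.+1, x.+1)%:R != 0 :> R by rewrite pnatr_eq0 -lt0n bin_gt0.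
have C1 : 'C(n, x)%:R != 0 :> R by rewrite pnatr_eq0 -lt0n bin_gt0.
have : n.+1%:R * 'C(n, x)%:R = x.+1%:R * 'C(n.+1, x.+1)%:R :> R by rewrite -!natrM mul_bin_diag.
have N0 : n.+1%:R != 0 :> R by rewrite pnatr_eq0.
move=> /(canRL (mulKf N0)) ->; field; by rewrite ?C0 ?C1 !nat1r !pnatr_eq0.
Qed.

(** With al = x / n, [kap_step] and [kap_decay] bound the k-th term by a multiple of al / (1 + (k +
    1) al)^3. This is dominated by the telescoping difference of 1 / (1 + k al), whose sum is at
    most 1 for all [n] and [x]. *)
Lemma kap_step_sum n x : (2 * x <= n)%N ->
  \sum_(k < n./2) k.+1%:R * (kap n k.+1 x - kap n k x) ^+ 2 <= 2 ^+ 22.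
Proof.
case: x => [|x] xn.
  rewrite big1 ?exprn_ge0 // => k _.
  have kn : (k.+1 <= n)%N by move: (ltn_ord k); lia.
  have k1 j : (j <= n)%N -> kap n j 0 = 1.
    by move=> jn; rewrite /kap kraw_at0 divff // pnatr_eq0 -lt0n bin_gt0.
  by rewrite !k1 ?subrr ?expr0n ?mulr0 // ltnW.
case: n xn => // n xn.
have small k : (k < n.+1./2)%N ->
    [/\ (0 < n)%N, (k <= n)%N, (2 * x <= n)%N, (2 * k <= n)%N
      & (k.+1 * x.+1 <= k * x + 2 * n)%N].
  by move=> kn; split; nia.
pose al : R := x.+1%:R / n.+1%:R.
have al0 : 0 <= al by rewrite divr_ge0.
have T m : \sum_(k < m) ((1 + k%:R * al)^-1 - (1 + k.+1%:R * al)^-1) = 1 - (1 + m%:R * al)^-1.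
  elim: m => [|m IH]; first by rewrite big_ord0 mul0r addr0 invr1 subrr.
  by rewrite big_ord_recr /= IH; ring.
apply: (@le_trans _ _ (2 ^+ 22 * \sum_(k < n.+1./2) ((1 + k%:R * al)^-1 - (1 + k.+1%:R * al)^-1))); last first.
  rewrite T ler_piMr ?exprn_ge0 // gerDl oppr_le0 invr_ge0 addr_ge0 // mulr_ge0 //.
rewrite mulr_sumr; apply: ler_sum => k _; have [n0 kn xn' kn' knx] := small k (ltn_ord k).
rewrite kap_step //; last by apply: leq_trans xn'; rewrite leq_pmull.
rewrite -/al.
have N0 : 0 < n%:R :> R by rewrite ltr0n.
have := @kap_decay n k x n0 kn' xn'.
set z := 1 + k%:R * al; set y := 1 + k.+1%:R * al.
have rk : k.+1%:R = k%:R + 1 :> R by rewrite natr1.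
have k0 : 0 <= k%:R :> R by [].
have ka0 : 0 <= k%:R * al by rewrite mulr_ge0.
have yz : y = z + al by rewrite /y /z rk; ring.
have z1 : 1 <= z by rewrite lerDl.
have y0 : 0 < y by lra.
(* Shifting [(k, x)] to [(k + 1, x + 1)] adds at most 2, which the 28 of [kap_decay] absorbs. *)
have y1 : y <= 28 + k%:R * x%:R / n%:R.
  have : k.+1%:R * al <= k.+1%:R * x.+1%:R / n%:R.
    rewrite /al -mulrA ler_wpM2l // ler_wpM2l // lef_pV2 ?posrE ?ltr0n // ler_nat //.
  have : k.+1%:R * x.+1%:R / n%:R <= k%:R * x%:R / n%:R + 2 :> R.
    rewrite ler_pdivrMr // mulrDl divfK ?gt_eqF // -!natrM -natrD ler_nat //.
  by rewrite /y; lra.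
move=> D; have {}D : `|kap n k x| <= (32 / y) ^+ 2.
  apply: le_trans D _; rewrite ler_pXn2r ?nnegrE ?divr_ge0 //; try lra.
  by rewrite ler_wpM2l // lef_pV2 ?posrE //; lra.
have K2 : kap n k x ^+ 2 <= 2 ^+ 20 / y ^+ 4.
  rewrite -real_normK ?num_real //.
  have -> : 2 ^+ 20 / y ^+ 4 = ((32 / y) ^+ 2) ^+ 2.
    by field; rewrite gt_eqF.
  by rewrite ler_pXn2r ?nnegrE ?sqr_ge0.
have -> : z^-1 - y^-1 = al / (z * y) by rewrite yz; field; rewrite !gt_eqF //; lra.
have -> : k.+1%:R * (- 2 * al * kap n k x) ^+ 2 = 4 * al * (k.+1%:R * al) * kap n k x ^+ 2 by ring.
apply: (@le_trans _ _ (4 * al * y * (2 ^+ 20 / y ^+ 4))).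
  apply: ler_pM => //; rewrite ?sqr_ge0 //.
    by apply: mulr_ge0; apply: mulr_ge0.
  by apply: ler_wpM2l; [rewrite mulr_ge0 | rewrite /y lerDr].
have -> : 4 * al * y * (2 ^+ 20 / y ^+ 4) = 2 ^+ 22 * (al / y ^+ 3).
  by field; rewrite gt_eqF.
rewrite ler_wpM2l ?exprn_ge0 // ler_wpM2l // lef_pV2 ?posrE ?exprn_gt0 ?mulr_gt0 //; last lra.
rewrite exprSr ler_wpM2r ?(ltW y0) //; nra.
Qed.

Lemma sum_pairs (F : nat -> R) m :
  \sum_(k < 2 * m) F k = \sum_(j < m) (F (2 * j)%N + F (2 * j).+1).
Proof.
elim: m => [|m IH]; first by rewrite !big_ord0.
by rewrite mulnS !big_ord_recr /= IH addrA.
Qed.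

(** The reflection x -> n - x multiplies [kap n k] by (-1)^k, so it preserves differences between
    even indices and brings [x] below n/2. Each double step is then split into two single ones. *)
Lemma kap_even_step_sum n x : (x <= n)%N ->
  \sum_(j < n %/ 4) j.+1%:R * (kap n (2 * j.+1) x - kap n (2 * j) x) ^+ 2 <= 2 ^+ 23.
Proof.
wlog xn2 : x / (2 * x <= n)%N.
  move=> H xn; have [/H|xn2] := leqP (2 * x) n; first exact.
  have := H (n - x)%N ltac:(lia) ltac:(lia); congr (_ <= _).
  apply: eq_bigr => j _; rewrite !kap_compl // !exprM !sqrrN !expr1n !mul1r //.
move=> _; have F0 k : 0 <= k.+1%:R * (kap n k.+1 x - kap n k x) ^+ 2 by rewrite mulr_ge0 ?sqr_ge0.
apply: (@le_trans _ _ (2 * \sum_(k < 2 * (n %/ 4)) k.+1%:R * (kap n k.+1 x - kap n k x) ^+ 2)); last first.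
  have -> : 2 ^+ 23 = 2 * 2 ^+ 22 :> R by rewrite -exprS.
  rewrite ler_wpM2l //; apply: le_trans (kap_step_sum xn2).
  have -> : (n./2 = 2 * (n %/ 4) + (n./2 - 2 * (n %/ 4)))%N by lia.
  by rewrite [leRHS]big_split_ord /= lerDl; apply: sumr_ge0.
rewrite (sum_pairs (fun k => k.+1%:R * (kap n k.+1 x - kap n k x) ^+ 2)) mulr_sumr.
apply: ler_sum => j _; rewrite mulnS.
set d := kap n (2 * j).+1 x - _; set e := kap n (2 * j).+2 x - kap n (2 * j).+1 x.
have -> : kap n (2 + 2 * j) x - kap n (2 * j) x = d + e by rewrite /d /e; ring.
apply: (@le_trans _ _ (j.+1%:R * (2 * (d ^+ 2 + e ^+ 2)))).
  by rewrite ler_wpM2l //; have := sqr_ge0 (d - e); lra.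
have j1 : j.+1%:R <= (2 * j).+1%:R :> R by rewrite ler_nat ltnS leq_pmull.
have j2 : j.+1%:R <= (2 * j).+2%:R :> R by apply: le_trans j1 _; rewrite ler_nat.
have := ler_wpM2r (sqr_ge0 d) j1; have := ler_wpM2r (sqr_ge0 e) j2; lra.
Qed.

End Krawtchouk.

(** * The Ehrenfest walk *)

Section Ehrenfest.
Variables (R : realFieldType) (n : nat).
Hypothesis n_gt0 : (0 < n)%N.

(* Generator form of the Ehrenfest walk; the junk values [phi n.+1] at [r = n] and
   [phi 0.-1] at [r = 0] have weight 0. *)
Definition ehr (phi : nat -> R) (r : nat) : R :=
  (n - r)%:R / n%:R * phi r.+1 + r%:R / n%:R * phi r.-1.

(** In [t] steps from [r0] the walk stays in [0, n] and reaches at most [r0 + t], so values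
    elsewhere are irrelevant. *)
Lemma iter_ehr_le t phi psi r0 : (r0 <= n)%N ->
  (forall r, (r <= n)%N -> (r <= r0 + t)%N -> phi r <= psi r) ->
  iter t ehr phi r0 <= iter t ehr psi r0.
Proof.
elim: t r0 => [|t IH] r0 r0n H; first by apply: H; rewrite ?addn0.
rewrite /= /ehr lerD //.
  have [->|r0n'] := eqVneq r0 n; first by rewrite subnn !mul0r.
  rewrite ler_wpM2l ?divr_ge0 //; apply: IH; first by rewrite ltn_neqAle r0n'.
  by move=> r rn rt; apply: H => //; rewrite addnS -addSn.
rewrite ler_wpM2l ?divr_ge0 //; apply: IH; first exact: leq_trans (leq_pred _) r0n.
move=> r rn rt; apply: H => //; apply: leq_trans rt _.
by rewrite addnS -addSn leq_add2r; apply: leq_trans (leq_pred _) _.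
Qed.

Lemma iter_ehr_lin t a b phi psi r :
  iter t ehr (fun k => a * phi k + b * psi k) r =
  a * iter t ehr phi r + b * iter t ehr psi r.
Proof. by elim: t r => [|t IH] r //=; rewrite /ehr !IH; ring. Qed.

Lemma iter_ehr_sum t m (c : nat -> R) (phi : nat -> nat -> R) r :
  iter t ehr (fun k => \sum_(s < m) c s * phi s k) r =
  \sum_(s < m) c s * iter t ehr (phi s) r.
Proof.
elim: t r => [|t IH] r //=; rewrite {1}/ehr !IH !mulr_sumr -big_split /=.
by apply: eq_bigr => s _; rewrite /ehr; ring.
Qed.

Lemma iter_ehr_eq t phi psi r0 : (r0 <= n)%N ->
  (forall r, (r <= n)%N -> phi r = psi r) -> iter t ehr phi r0 = iter t ehr psi r0.
Proof.
move=> r0n H; apply/eqP; rewrite eq_le.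
by apply/andP; split; apply: iter_ehr_le => // r rn _; rewrite H.
Qed.

Lemma iter_ehr1 t r : (r <= n)%N -> iter t ehr (fun=> 1) r = 1.
Proof.
elim: t r => [//|t IH] r rn; rewrite iterSr -[RHS](IH r rn).
apply: iter_ehr_eq => // k kn; rewrite /ehr !mulr1 -mulrDl -natrD subnK //.
by rewrite divff // pnatr_eq0 -lt0n.
Qed.

Lemma iter_ehr_mean_rec t :
  iter t.+1 ehr (fun r => r%:R) 0 = 1 + (1 - 2 / n%:R) * iter t ehr (fun r => r%:R) 0%N.
Proof.
rewrite iterSr -[X in _ = X + _]mulr1 -[X in _ = _ * X + _](iter_ehr1 t (leq0n n)).
rewrite -iter_ehr_lin.
apply: iter_ehr_eq => // r rn; rewrite /ehr natrB //.
have n0 : n%:R != 0 :> R by rewrite pnatr_eq0 -lt0n.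
by case: r rn => [|r] rn /=; field.
Qed.

(** The mean at time [t] is at most [t], so the drift there is at least 1 - 2t/n; these drifts are
    summed. *)
Lemma iter_ehr_mean_ge t :
  t%:R - t%:R * (t%:R - 1) / n%:R <= iter t ehr (fun r => r%:R) 0%N.
Proof.
have N0 : 0 < n%:R :> R by rewrite ltr0n.
have ge0 u r : 0 <= iter u ehr (fun r => r%:R) r.
  by elim: u r => [|u IH] r //=; rewrite addr_ge0 // mulr_ge0 ?divr_ge0.
have le_t u : iter u ehr (fun r => r%:R) 0%N <= u%:R.
  elim: u => [|u IH] //; rewrite iter_ehr_mean_rec mulrBl mul1r -natr1.
  by have : 0 <= 2 / n%:R * iter u ehr (fun r => r%:R) 0%N; [rewrite mulr_ge0 ?divr_ge0 | lra].
elim: t => [|t IH]; first by rewrite !mul0r subrr.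
rewrite iter_ehr_mean_rec; set c := iter t _ _ _ in IH *.
have : 2 / n%:R * c <= 2 / n%:R * t%:R by rewrite ler_wpM2l ?divr_ge0 // le_t.
have -> : t.+1%:R - t.+1%:R * (t.+1%:R - 1) / n%:R =
   1 + (t%:R - t%:R * (t%:R - 1) / n%:R) - 2 / n%:R * t%:R :> R.
  by rewrite -natr1; field; rewrite gt_eqF.
rewrite mulrBl mul1r; lra.
Qed.

(* The flux of the chain through the edge (s, s+1): each net upcrossing is paid by a visit at s. *)
Lemma ehr_visits s T :
  iter T ehr (fun r => (s < r)%:R) 0%N <= \sum_(t < T) iter t ehr (fun r => (r == s)%:R) 0%N.
Proof.
have N0 : 0 < n%:R :> R by rewrite ltr0n.
elim: T => [|T IH]; first by rewrite big_ord0.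
rewrite big_ord_recr iterSr; apply: le_trans (lerD IH (lexx _)).
rewrite -[X in _ <= X + _]mul1r -[X in _ <= _ + X]mul1r -iter_ehr_lin.
apply: iter_ehr_le => // r rn _; rewrite /ehr !mul1r.
have c1 : (n - r)%:R / n%:R + r%:R / n%:R = 1 :> R.
  by rewrite -mulrDl -natrD subnK // divff // gt_eqF.
have a0 : 0 <= (n - r)%:R / n%:R :> R by rewrite divr_ge0.
have b0 : 0 <= r%:R / n%:R :> R by rewrite divr_ge0.
case: (ltngtP r s) => rs /=.
- have -> : (s < r.+1)%N = false by rewrite ltnS leqNgt rs.
  have -> : (s < r.-1)%N = false.
    by apply/negbTE; rewrite -leqNgt; apply: leq_trans (leq_pred _) (ltnW rs).
  by rewrite !mulr0 addr0.
- have -> : (s < r.+1)%N by exact: leqW.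
  by case: (s < r.-1)%N; rewrite ?mulr1 ?mulr0 /=; lra.
- have -> : (s < r.+1)%N by rewrite rs.
  have -> : (s < r.-1)%N = false by rewrite -rs; case: (r) => //= r'; rewrite ltnNge leqnSn.
  by rewrite mulr0 mulr1 addr0 add0r; lra.
Qed.

(** At time T = 2K + 1 the mean is at least T (1 - 2K/n) >= 3T/4. As the level is at most T, the
    mean is also at most s + T P(level > s). Since s <= K <= T/2, this probability is at least 1/4,
    and [ehr_visits] converts it into visits. *)
Lemma ehr_green K s : (8 * K <= n)%N -> (s <= K)%N ->
  1 / 4 <= \sum_(t < (2 * K).+1) iter t ehr (fun r => (r == s)%:R) 0%N.
Proof.
move=> Kn sK; apply: le_trans (ehr_visits _ _); set T := (2 * K).+1.
have N0 : 0 < n%:R :> R by rewrite ltr0n.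
have H : iter T ehr (fun r => r%:R) 0%N <= s%:R + T%:R * iter T ehr (fun r => (s < r)%:R) 0%N.
  rewrite -[X in _ <= X + _]mulr1 -[X in _ <= _ * X + _](iter_ehr1 T (leq0n n)) -iter_ehr_lin.
  apply: iter_ehr_le => // r rn; rewrite add0n => rT; rewrite mulr1.
  case: ltnP => rs; first by rewrite mulr1 -natrD ler_nat; apply: leq_trans rT (leq_addl _ _).
  by rewrite mulr0 addr0 ler_nat.
have T0 : 0 < T%:R :> R by rewrite ltr0n.
rewrite -(ler_pM2l T0); have := iter_ehr_mean_ge T.
have TE : T%:R = 2 * K%:R + 1 :> R by rewrite /T -natr1 natrM.
have -> : T%:R * (T%:R - 1) / n%:R = T%:R * (2 * K%:R / n%:R) :> R by rewrite TE addrK; ring.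
have : T%:R * (2 * K%:R / n%:R) <= T%:R * (1 / 4) :> R.
  rewrite ler_wpM2l // ler_pdivrMr // mulrAC mulrC.
  have : 8 * K%:R <= n%:R :> R by rewrite -natrM ler_nat.
  lra.
have : s%:R <= K%:R :> R by rewrite ler_nat.
lra.
Qed.

Lemma ehr_sum_ge K (phi : nat -> R) : (8 * K <= n)%N -> (forall r, 0 <= phi r) ->
  \sum_(s < K.+1) phi s <= 4 * \sum_(t < (2 * K).+1) iter t ehr phi 0%N.
Proof.
move=> Kn phi0.
apply: (@le_trans _ _ (4 * \sum_(t < (2 * K).+1)
    \sum_(s < K.+1) phi s * iter t ehr (fun r => (r == s)%:R) 0%N)).
  rewrite exchange_big /= mulr_sumr; apply: ler_sum => s _.
  rewrite -mulr_sumr mulrCA; have sK : (s <= K)%N by rewrite -ltnS.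
  have := ler_wpM2l (phi0 s) (ehr_green Kn sK); lra.
rewrite ler_wpM2l //; apply: ler_sum => t _.
rewrite -(iter_ehr_sum t K.+1 phi (fun s r => (r == s)%:R)).
apply: iter_ehr_le => // r rn _.
have [rK|rK] := ltnP r K.+1.
  rewrite (bigD1 (Ordinal rK)) //= eqxx mulr1 big1 ?addr0 // => i ir.
  suff -> : (r == i) = false by rewrite mulr0.
  by apply/negbTE; apply: contra ir => /eqP e; apply/eqP/val_inj.
rewrite big1 // => i _; suff -> : (r == i) = false by rewrite mulr0.
by apply/negbTE; rewrite neq_ltn (leq_trans (ltn_ord i) rK) orbT.
Qed.

End Ehrenfest.

(** * Spherical means as Fourier multipliers, and their link with the Ehrenfest walk *)

Section SphericalMeans.
Variable R : realFieldType.
Implicit Types n : nat.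

Lemma sph_mean_ge0 n k (f : cube n -> R) x : (forall y, 0 <= f y) -> 0 <= sph_mean k f x.
Proof. by move=> f0; rewrite mulr_ge0 ?invr_ge0 // sumr_ge0. Qed.

Lemma fourier_multiplier_sum n (J : finType) (c : J -> R) (m : J -> nat -> R)
    (g : J -> cube n -> R) (f : cube n -> R) (C : R) :
  (forall j a, fourier (g j) a = m j (wt a) * fourier f a) ->
  (forall w, (w <= n)%N -> \sum_j c j * m j w ^+ 2 <= C) ->
  \sum_x \sum_j c j * g j x ^+ 2 <= C * \sum_x f x ^+ 2.
Proof.
move=> Hg Hm; have P0 : 0 < 2 ^+ n :> R by rewrite exprn_gt0.
rewrite -(ler_pM2l P0) [leRHS]mulrCA -plancherel.
have -> : 2 ^+ n * (\sum_x \sum_j c j * g j x ^+ 2) =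
    \sum_j \sum_a c j * fourier (g j) a ^+ 2.
  rewrite exchange_big mulr_sumr /=; apply: eq_bigr => j _.
  by rewrite -!mulr_sumr plancherel mulrCA.
rewrite exchange_big /= mulr_sumr; apply: ler_sum => a _.
apply: le_trans (ler_wpM2r (sqr_ge0 (fourier f a)) (Hm _ (wt_le a))).
by rewrite mulr_suml; apply: ler_sum => j _; rewrite Hg exprMn mulrA.
Qed.

Lemma sph_mean_l2 n k (f : cube n -> R) :
  \sum_x sph_mean k f x ^+ 2 <= \sum_x f x ^+ 2.
Proof.
have := @fourier_multiplier_sum n unit (fun=> 1) (fun=> kap R n k) (fun=> sph_mean k f) f 1.
rewrite mul1r => H; apply: le_trans (H _ _); last first.
- move=> w wn; rewrite (big_pred1 tt); last by case.
  by rewrite mul1r -real_normK ?num_real // expr_le1 // kap_bound.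
- by move=> _ a; rewrite fourier_sph_mean.
by apply: ler_sum => x _; rewrite (big_pred1 tt); [rewrite mul1r | case].
Qed.

Lemma sph_mean1_comp n k (f : cube n -> R) x : (0 < n)%N -> (k <= n)%N ->
  sph_mean 1 (sph_mean k f) x =
  k%:R / n%:R * sph_mean k.-1 f x + (n - k)%:R / n%:R * sph_mean k.+1 f x.
Proof.
move=> n0 kn; pose g y := k%:R / n%:R * sph_mean k.-1 f y + (n - k)%:R / n%:R * sph_mean k.+1 f y.
rewrite -/(g x); apply: fourier_inj x => a.
have -> : fourier g a =
    k%:R / n%:R * fourier (sph_mean k.-1 f) a + (n - k)%:R / n%:R * fourier (sph_mean k.+1 f) a.
  by rewrite /fourier !mulr_sumr -big_split; apply: eq_bigr => y _; rewrite /g /=; ring.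
rewrite !fourier_sph_mean mulrA.
have N0 : n%:R != 0 :> R by rewrite pnatr_eq0 -lt0n.
have := kap_three_term R kn (wt_le a); rewrite -natrB // => /(canRL (mulKf N0)) ->.
by field.
Qed.

Lemma sph_mean_comm n j k (f : cube n -> R) x :
  sph_mean j (sph_mean k f) x = sph_mean k (sph_mean j f) x.
Proof. by apply: fourier_inj x => a; rewrite !fourier_sph_mean mulrCA. Qed.

Definition nbr n (x y : cube n) : R := n%:R^-1 * (hamming x y == 1%N)%:R.

Lemma nbr_ge0 n (x y : cube n) : 0 <= nbr x y.
Proof. by rewrite mulr_ge0 ?invr_ge0. Qed.

Lemma nbr_sym n (x y : cube n) : nbr x y = nbr y x.
Proof. by rewrite /nbr hammingC. Qed.

Lemma kact_nbr n (f : cube n -> R) x : kact (@nbr n) f x = sph_mean 1 f x.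
Proof.
rewrite /kact /sph_mean bin1 mulr_sumr [RHS]big_mkcond; apply: eq_bigr => y _.
by rewrite /nbr; case: (_ == _); rewrite ?mulr1 // mulr0 mul0r.
Qed.

Lemma nbr_sum1 n (x : cube n) : (0 < n)%N -> \sum_y nbr x y = 1.
Proof.
move=> n0; rewrite -mulr_sumr -natr_sum; have := card_sphere R 1 x.
rewrite -sum1_card big_mkcond /= bin1 => ->.
by rewrite mulVf // pnatr_eq0 -lt0n.
Qed.

(** By [sph_mean1_comp], [S_1] acts on the sequence of means through [ehr]: the distance of the
    nearest-neighbour walk from a fixed point is the Ehrenfest walk. *)
Lemma iter_nbr_sph_mean n t k (f : cube n -> R) x : (0 < n)%N -> (k <= n)%N ->
  kact (kpow (@nbr n) t) (sph_mean k f) x = iter t (ehr n) (fun r => sph_mean r f x) k.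
Proof.
move=> n0; elim: t k => [|t IH] k kn; first by rewrite kact_kpow.
rewrite kact_kpow iterSr -kact_kpow iterS {1}/ehr.
have E y : kact (@nbr n) (sph_mean k f) y =
    k%:R / n%:R * sph_mean k.-1 f y + (n - k)%:R / n%:R * sph_mean k.+1 f y.
  by rewrite kact_nbr sph_mean1_comp.
have -> : kact (kpow (@nbr n) t) (kact (@nbr n) (sph_mean k f)) x =
    k%:R / n%:R * kact (kpow (@nbr n) t) (sph_mean k.-1 f) x +
    (n - k)%:R / n%:R * kact (kpow (@nbr n) t) (sph_mean k.+1 f) x.
  by rewrite /kact !mulr_sumr -big_split; apply: eq_bigr => y _; rewrite -/(kact _ _ y) E /=; ring.
rewrite addrC [in X in _ + X]IH ?(leq_trans (leq_pred _) kn) //; congr (_ + _).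
have [->|kn'] := eqVneq k n; first by rewrite subnn !mul0r.
by rewrite IH // ltn_neqAle kn'.
Qed.

Lemma sph_mean0 n (f : cube n -> R) x : sph_mean 0 f x = f x.
Proof.
rewrite /sph_mean bin0 invr1 mul1r (bigD1 x) /=; last first.
  by rewrite hammingE big1 // => i _; rewrite eqxx.
rewrite big1 ?addr0 // => y /andP[/eqP h yx]; case/eqP: yx; apply/ffunP => i.
apply/eqP; move: h; rewrite hammingE => /eqP; rewrite sum_nat_eq0 => /forallP/(_ i).
by rewrite /= eqb0 negbK eq_sym.
Qed.

Lemma sum_sph_mean_le n K (f : cube n -> R) x :
  (0 < n)%N -> (8 * K <= n)%N -> (forall y, 0 <= f y) ->
  \sum_(s < K.+1) sph_mean s f x <=
  4 * (2 * K).+1%:R * kact (cesaro (@nbr n) (2 * K).+1) f x.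
Proof.
move=> n0 Kn f0; have := @ehr_sum_ge R n n0 K (fun r => sph_mean r f x) Kn (fun r => sph_mean_ge0 r x f0).
move=> /le_trans; apply.
rewrite -mulrA ler_wpM2l // kact_cesaro mulVKf ?pnatr_eq0 //.
apply: ler_sum => t _; rewrite -iter_nbr_sph_mean // -kact_kpow /kact.
by apply: ler_sum => y _; rewrite sph_mean0.
Qed.

Lemma sph_mean_compl n k (f : cube n -> R) x : (k <= n)%N ->
  sph_mean (n - k) f (compl x) = sph_mean k f x.
Proof.
move=> kn; rewrite /sph_mean bin_sub //; congr (_ * _); apply: eq_bigl => y.
rewrite hamming_compl; have : (hamming x y <= n)%N.
  by rewrite -[leqRHS]card_ord; exact: max_card.
lia.
Qed.

End SphericalMeans.

(** * Spherical maximal function *)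

Section MaximalFunction.
Variable R : realFieldType.

(** Summation by parts writes m + 1 times the deviation as the sum of (j + 1)(s_(j+1) - s_j);
    Cauchy-Schwarz and (j + 1)^2 <= (j + 1) m then finish. *)
Lemma sub_mean_sqr_le (s : nat -> R) m :
  (s m - m.+1%:R^-1 * \sum_(j < m.+1) s j) ^+ 2 <=
  \sum_(j < m) j.+1%:R * (s j.+1 - s j) ^+ 2.
Proof.
have -> : s m - m.+1%:R^-1 * \sum_(j < m.+1) s j =
    m.+1%:R^-1 * \sum_(j < m) 1 * (j.+1%:R * (s j.+1 - s j)).
  have E : m.+1%:R * s m - \sum_(j < m.+1) s j = \sum_(j < m) 1 * (j.+1%:R * (s j.+1 - s j)).
    elim: m => [|m IH]; first by rewrite big_ord1 big_ord0 mul1r subrr.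
    by rewrite [RHS]big_ord_recr -IH [X in _ - X]big_ord_recr /=; ring.
  by rewrite -E mulrBr mulKf ?pnatr_eq0.
rewrite exprMn exprVn -(ler_pM2l (x := m.+1%:R ^+ 2)) ?exprn_gt0 // mulVKf; last first.
  by rewrite expf_neq0 ?pnatr_eq0.
apply: le_trans (sum_cauchy_schwarz _ _ _ _) _.
have -> : \sum_(i < m) (1 : R) ^+ 2 = m%:R.
  by under eq_bigr => i _ do rewrite expr1n; rewrite sumr_const card_ord.
have S0 (c : 'I_m -> R) : (forall j, 0 <= c j) -> 0 <= \sum_(j < m) c j * (s j.+1 - s j) ^+ 2.
  by move=> c0; apply: sumr_ge0 => j _; rewrite mulr_ge0 ?sqr_ge0.
have mm : m%:R <= m.+1%:R :> R by rewrite ler_nat.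
rewrite (expr2 m.+1%:R) -mulrA; apply: ler_pM => //.
  by apply: sumr_ge0 => j _; exact: sqr_ge0.
rewrite mulr_sumr; apply: ler_sum => j _.
have jm : j.+1%:R <= m%:R :> R by rewrite ler_nat.
rewrite exprMn [leRHS]mulrA; apply: ler_wpM2r; first exact: sqr_ge0.
by rewrite expr2; apply: ler_wpM2r => //; apply: le_trans jm mm.
Qed.

(** The square of the Nevo-Stein square function, over even radii up to n/2. *)
Definition square_fun n (f : cube n -> R) x : R :=
  \sum_(j < n %/ 4) j.+1%:R * (sph_mean (2 * j.+1) f x - sph_mean (2 * j) f x) ^+ 2.

Lemma square_fun_l2 n (f : cube n -> R) :
  \sum_x square_fun f x <= 2 ^+ 23 * \sum_x f x ^+ 2.
Proof.
apply: (@fourier_multiplier_sum R n 'I_(n %/ 4) (fun j => j.+1%:R) (fun j w => kap R n (2 * j.+1) w - kap R n (2 * j) w)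
  (fun j y => sph_mean (2 * j.+1) f y - sph_mean (2 * j) f y) f) => [j a|w wn].
  rewrite mulrBl -!fourier_sph_mean -sumrB.
  by apply: eq_bigr => y _; rewrite mulrBl.
exact: kap_even_step_sum.
Qed.

Definition even_mean n m (f : cube n -> R) x : R :=
  m.+1%:R^-1 * \sum_(j < m.+1) sph_mean (2 * j) f x.

Lemma even_mean_le n m (f : cube n -> R) x : (forall y, 0 <= f y) ->
  even_mean m f x <= m.+1%:R^-1 * \sum_(i < (2 * m).+1) sph_mean i f x.
Proof.
move=> f0; rewrite ler_wpM2l ?invr_ge0 // [leRHS]big_ord_recr [leLHS]big_ord_recr /= lerD2r.
rewrite (sum_pairs (fun i => sph_mean i f x)); apply: ler_sum => j _; rewrite lerDl; exact: sph_mean_ge0.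
Qed.

(** For 16m <= n the walk comparison with K = 2m gives the factor 4(4m + 1)/(m + 1) <= 16. Otherwise
    1/(m + 1) <= 16/n, and the remaining radii are added by positivity. *)
Lemma even_mean_sqr_le n m (f : cube n -> R) x :
  (0 < n)%N -> (4 * m <= n)%N -> (forall y, 0 <= f y) ->
  even_mean m f x ^+ 2 <=
  256 * kact (cesaro (@nbr R n) (4 * m).+1) f x ^+ 2 +
  (16 / n%:R * \sum_(i < n.+1) sph_mean i f x) ^+ 2.
Proof.
move=> n0 mn f0.
have E0 : 0 <= even_mean m f x.
  by rewrite mulr_ge0 ?invr_ge0 // sumr_ge0 // => j _; exact: sph_mean_ge0.
have S0 : 0 <= \sum_(i < n.+1) sph_mean i f x by apply: sumr_ge0 => i _; exact: sph_mean_ge0.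
have A0 : 0 <= kact (cesaro (@nbr R n) (4 * m).+1) f x.
  apply: sumr_ge0 => y _; rewrite mulr_ge0 // cesaro_ge0 //; exact: nbr_ge0.
have M0 : 0 < m.+1%:R :> R by rewrite ltr0n.
have [m16|m16] := leqP (16 * m) n.
  apply: (@le_trans _ _ ((16 * kact (cesaro (@nbr R n) (4 * m).+1) f x) ^+ 2)); last first.
    have -> : (16 * kact (cesaro (@nbr R n) (4 * m).+1) f x) ^+ 2 =
      256 * kact (cesaro (@nbr R n) (4 * m).+1) f x ^+ 2 by ring.
    by rewrite lerDl sqr_ge0.
  apply: sqr_le_sqr => //; apply: le_trans (even_mean_le m x f0) _.
  have m8 : (8 * (2 * m) <= n)%N by rewrite mulnA.
  have := sum_sph_mean_le x n0 m8 f0; rewrite mulnA => H.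
  rewrite mulrC ler_pdivrMr //; apply: le_trans H _.
  rewrite [leRHS]mulrAC ler_wpM2r //.
  have -> : (4 * m).+1%:R = 4 * m%:R + 1 :> R by rewrite -natrM natr1.
  by rewrite -natr1; have : 0 <= m%:R :> R by []; lra.
apply: (@le_trans _ _ ((16 / n%:R * \sum_(i < n.+1) sph_mean i f x) ^+ 2)); last first.
  by rewrite lerDr mulr_ge0 ?sqr_ge0.
apply: sqr_le_sqr => //; apply: le_trans (even_mean_le m x f0) _.
apply: ler_pM; rewrite ?invr_ge0 //.
- by apply: sumr_ge0 => i _; exact: sph_mean_ge0.
- rewrite ler_pdivlMr ?ltr0n // mulrC ler_pdivrMr // -natrM ler_nat.
  by apply: ltnW; apply: leq_trans m16 _; rewrite leq_mul.
- have -> : n.+1 = ((2 * m).+1 + (n - 2 * m))%N by rewrite addSn subnKC //; apply: leq_trans mn; rewrite leq_mul.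
  by rewrite [leRHS]big_split_ord /= lerDl; apply: sumr_ge0 => i _; exact: sph_mean_ge0.
Qed.

(** Cauchy-Schwarz over the n + 1 radii and L2 contractivity of each mean; the constant is (16 (n +
    1)/n)^2 <= 32^2. *)
Lemma full_mean_l2 n (f : cube n -> R) : (0 < n)%N ->
  \sum_x (16 / n%:R * \sum_(i < n.+1) sph_mean i f x) ^+ 2 <= 1024 * \sum_x f x ^+ 2.
Proof.
move=> n0; have N0 : 0 < n%:R :> R by rewrite ltr0n.
have N1 : 1 <= n%:R :> R by rewrite ler1n.
set F := \sum_x f x ^+ 2.
have F0 : 0 <= F by apply: sumr_ge0 => x _; exact: sqr_ge0.
under eq_bigr => x _ do rewrite exprMn.
rewrite -mulr_sumr.
apply: (@le_trans _ _ ((16 / n%:R) ^+ 2 * (n.+1%:R * (n.+1%:R * F)))).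
  rewrite ler_wpM2l ?sqr_ge0 //.
  apply: (@le_trans _ _ (\sum_x n.+1%:R * \sum_(i < n.+1) sph_mean i f x ^+ 2)).
    apply: ler_sum => x _.
    have := sum_cauchy_schwarz (index_enum _) xpredT (fun _ : 'I_n.+1 => 1) (fun i => sph_mean i f x).
    under eq_bigr => i _ do rewrite mul1r.
    under [X in _ <= X * _ -> _]eq_bigr => i _ do rewrite expr1n.
    by rewrite sumr_const card_ord.
  rewrite -mulr_sumr ler_wpM2l // exchange_big /=.
  have -> : n.+1%:R * F = \sum_(i < n.+1) F by rewrite sumr_const card_ord mulr_natl.
  by apply: ler_sum => i _; exact: sph_mean_l2.
have -> : (16 / n%:R) ^+ 2 * (n.+1%:R * (n.+1%:R * F)) = (16 * (n.+1%:R / n%:R)) ^+ 2 * F.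
  by field; rewrite gt_eqF.
rewrite ler_wpM2r //.
have -> : 1024 = 32 ^+ 2 :> R by ring.
apply: sqr_le_sqr; first by rewrite mulr_ge0 ?divr_ge0.
by rewrite mulrA ler_pdivrMr // -natr1; lra.
Qed.

(** The 32 comes from [maximal_ergodic], 256 and 1024 from the two parts of the even mean, [2 ^+ 23]
    from the square function, and the outer factors 2 from a^2 <= 2(a - b)^2 + 2b^2. *)
Definition C_even : R := 2 * (256 * 32 + 1024) + 2 * 2 ^+ 23.

Lemma C_even_ge0 : 0 <= C_even.
Proof. by rewrite /C_even; lra. Qed.

Lemma even_maximal n (f : cube n -> R) (k : cube n -> nat) :
  (0 < n)%N -> (forall y, 0 <= f y) -> (forall x, ~~ odd (k x)) -> (forall x, (2 * k x <= n)%N) ->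
  \sum_x sph_mean (k x) f x ^+ 2 <= C_even * \sum_x f x ^+ 2.
Proof.
move=> n0 f0 ke kn; pose m x := (k x)./2.
have km x : k x = (2 * m x)%N by rewrite /m mul2n even_halfK.
have mn x : (4 * m x <= n)%N by have := kn x; rewrite km mulnA.
pose A x := kact (cesaro (@nbr R n) (4 * m x).+1) f x.
pose H x := 16 / n%:R * \sum_(i < n.+1) sph_mean i f x.
set F := \sum_x f x ^+ 2.
have P x : sph_mean (k x) f x ^+ 2 <= 512 * A x ^+ 2 + 2 * H x ^+ 2 + 2 * square_fun f x.
  have D := sub_mean_sqr_le (fun j => sph_mean (2 * j) f x) (m x).
  have {}D : (sph_mean (2 * m x) f x - even_mean (m x) f x) ^+ 2 <= square_fun f x.
    apply: le_trans D _; have mq : (m x <= n %/ 4)%N by rewrite leq_divRL // mulnC.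
    rewrite /square_fun -(subnKC mq) big_split_ord /= lerDl.
    by apply: sumr_ge0 => j _; rewrite mulr_ge0 ?sqr_ge0.
  have E := even_mean_sqr_le x n0 (mn x) f0; rewrite -/(A x) -/(H x) in E.
  rewrite km; set a := sph_mean _ _ _ in D *; set b := even_mean _ _ _ in D E.
  have := sqr_ge0 (a - b - b).
  have -> : (a - b - b) ^+ 2 = 2 * (a - b) ^+ 2 + 2 * b ^+ 2 - a ^+ 2 by ring.
  lra.
apply: (@le_trans _ _ (\sum_x (512 * A x ^+ 2 + 2 * H x ^+ 2 + 2 * square_fun f x))).
  by apply: ler_sum.
rewrite !big_split /= -!mulr_sumr.
have := square_fun_l2 f; have := full_mean_l2 f n0.
have := @maximal_ergodic R _ (@nbr R n) (@nbr_ge0 R n) (@nbr_sym R n) (fun x => nbr_sum1 R x n0)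
   (fun x => (4 * m x).+1) f (fun=> isT) f0.
rewrite -/F /C_even; lra.
Qed.

(** [S_1 S_(k-1)] puts weight (n - k + 1)/n >= 1/2 on [S_k], and its other term is nonnegative. *)
Lemma odd_sph_mean_le n k (f : cube n -> R) x : (0 < n)%N -> (forall y, 0 <= f y) ->
  odd k -> (2 * k <= n)%N ->
  sph_mean k f x <= 2 * sph_mean k.-1 (sph_mean 1 f) x.
Proof.
case: k => // k n0 f0 _ kn; have N0 : 0 < n%:R :> R by rewrite ltr0n.
have kn' : (k <= n)%N by lia.
have kn2 : (n <= 2 * (n - k))%N by lia.
rewrite /= sph_mean_comm sph_mean1_comp // mulrDr.
apply: (@le_trans _ _ (2 * ((n - k)%:R / n%:R * sph_mean k.+1 f x))); last first.
  by rewrite lerDr mulr_ge0 // mulr_ge0 ?divr_ge0 // sph_mean_ge0.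
rewrite mulrA mulrA ler_peMl ?sph_mean_ge0 // ler_pdivlMr // mul1r.
by rewrite -natrM ler_nat.
Qed.

Lemma half_maximal n (f : cube n -> R) (k : cube n -> nat) :
  (0 < n)%N -> (forall y, 0 <= f y) -> (forall x, (2 * k x <= n)%N) ->
  \sum_x sph_mean (k x) f x ^+ 2 <= 5 * C_even * \sum_x f x ^+ 2.
Proof.
move=> n0 f0 kn; set F := \sum_x f x ^+ 2.
(* Where the parity is wrong the even default radius 0 is used; the two bounds add up to 1 + 2^2 =
   5. *)
pose ke x := if odd (k x) then 0%N else k x.
pose ko x := if odd (k x) then (k x).-1 else 0%N.
have C0 := C_even_ge0.
have He : \sum_x sph_mean (ke x) f x ^+ 2 <= C_even * F.
  apply: even_maximal => // x; rewrite /ke; case: ifP => [|/negbT] //.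
have g0 y : 0 <= sph_mean 1 f y by exact: sph_mean_ge0.
have Ho : \sum_x sph_mean (ko x) (sph_mean 1 f) x ^+ 2 <= C_even * F.
  apply: (@le_trans _ _ (C_even * \sum_x sph_mean 1 f x ^+ 2)).
    apply: even_maximal => // x; rewrite /ko; case: ifP => //.
      by case: (k x) => //= j /negbTE ->.
    by move=> _; apply: leq_trans (kn x); rewrite leq_mul2l leq_pred.
  by rewrite ler_wpM2l // sph_mean_l2.
apply: (@le_trans _ _ (\sum_x (sph_mean (ke x) f x ^+ 2 + 4 * sph_mean (ko x) (sph_mean 1 f) x ^+ 2))).
  apply: ler_sum => x _; rewrite /ke /ko; case: ifP => kx; last first.
    by rewrite lerDl mulr_ge0 ?sqr_ge0.
  apply: (@le_trans _ _ ((2 * sph_mean (k x).-1 (sph_mean 1 f) x) ^+ 2)).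
    by apply: sqr_le_sqr; [exact: sph_mean_ge0 | exact: odd_sph_mean_le].
  by rewrite exprMn; have := sqr_ge0 (sph_mean 0 f x); lra.
rewrite big_split /= -mulr_sumr; lra.
Qed.

Lemma full_maximal n (f : cube n -> R) (k : cube n -> nat) :
  (0 < n)%N -> (forall y, 0 <= f y) -> (forall x, (k x <= n)%N) ->
  \sum_x sph_mean (k x) f x ^+ 2 <= 10 * C_even * \sum_x f x ^+ 2.
Proof.
move=> n0 f0 kn.
pose ks x := if (2 * k x <= n)%N then k x else 0%N.
(* Large radii are read at the antipode, where they become [n - k]; hence [kl] looks up [k] at
   [compl x], and [Hl] is reindexed. *)
pose kl x := if (2 * k (compl x) <= n)%N then 0%N else (n - k (compl x))%N.
have Hs : \sum_x sph_mean (ks x) f x ^+ 2 <= 5 * C_even * \sum_x f x ^+ 2.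
  by apply: half_maximal => // x; rewrite /ks; case: ifP.
have Hl : \sum_x sph_mean (kl x) f x ^+ 2 <= 5 * C_even * \sum_x f x ^+ 2.
  by apply: half_maximal => // x; rewrite /kl; case: ifP => //; lia.
rewrite (reindex_inj (can_inj (@complK n))) /= in Hl.
apply: (@le_trans _ _ (\sum_x (sph_mean (ks x) f x ^+ 2 + sph_mean (kl (compl x)) f (compl x) ^+ 2))).
  apply: ler_sum => x _; rewrite /ks /kl complK; case: ifP => kx.
    by rewrite lerDl sqr_ge0.
  by rewrite sph_mean_compl // lerDr sqr_ge0.
rewrite big_split /=; lra.
Qed.

Lemma sph_maxE n (f : cube n -> R) x : exists2 k, (k <= n)%N & sph_max f x = sph_mean k f x.
Proof.
rewrite /sph_max; elim/big_ind: _ => [|a b [i i1 ->] [j j1 ->]|i _].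
- by exists 0%N.
- by case: (leP (sph_mean i f x) (sph_mean j f x)) => _; [exists j | exists i].
- by exists (i : nat) => //; rewrite -ltnS.
Qed.

Lemma sph_max_l2 n (f : cube n -> R) : (0 < n)%N ->
  \sum_x sph_max f x ^+ 2 <= 10 * C_even * \sum_x f x ^+ 2.
Proof.
move=> n0.
(* A maximising radius is chosen at each point, and [f] is replaced by its absolute value to reach
   the nonnegative case. *)
have /fin_all_exists[k Hk] x : exists k : nat, (k <= n)%N /\ sph_max f x = sph_mean k f x.
  by have [k] := sph_maxE f x; exists k.
have := @full_maximal n (fun y => `|f y|) k n0 (fun y => normr_ge0 _) (fun x => (Hk x).1).
under [X in _ <= _ * X -> _]eq_bigr => x _ do rewrite real_normK ?num_real //.
apply: le_trans; apply: ler_sum => x _; rewrite (Hk x).2 -[leLHS]real_normK ?num_real //.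
apply: sqr_le_sqr => //; rewrite /sph_mean normrM normfV normr_nat.
by rewrite ler_wpM2l ?invr_ge0 // ler_norm_sum.
Qed.

End MaximalFunction.

Theorem theorem1 (R : realType) :
  exists A : R, forall (n : nat), (1 <= n)%N ->
    forall f : cube n -> R, l2norm (sph_max f) <= A * l2norm f.
Proof.
exists (Num.sqrt (10 * C_even R)) => n n0 f; rewrite /l2norm.
have C0 : 0 <= 10 * C_even R by rewrite mulr_ge0 ?C_even_ge0.
rewrite -sqrtrM // ler_sqrt ?sph_max_l2 // mulr_ge0 // sumr_ge0 // => x _; exact: sqr_ge0.
Qed.
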